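(* Let $\mathcal{P}$ be a probabilistic term rewrite system (PTRS) and let $\mathfrak{T}$ be a $\to_{\mathcal{P}}$-rewrite sequence tree (RST) of height $\operatorname{h}(\mathfrak{T}) > 0$ whose root is labeled with the term $t$, such that for every leaf $v$ of $\mathfrak{T}$ there exist a context $C_v$ and a substitution $\sigma_v$ with $t_v = C_v[t\sigma_v]$, where $t_v$ is the term labeling $v$. Then $\mathcal{P}$ is neither almost-surely terminating (AST) nor positively almost-surely terminating (PAST).
   Context: Terms are built over a finite signature $\Sigma$ and an infinite set of variables $\mathcal{V}$; $\mathcal{T}$ is the set of terms. A substitution $\sigma$ maps variables to terms, has finite domain $\{x \mid x\sigma \neq x\}$, and is extended homomorphically to terms. $\operatorname{Pos}(s)$ is the set of positions of $s$, $s|_\pi$ is the subterm at $\pi$, and $s[r]_\pi$ is $s$ with the subterm at $\pi$ replaced by $r$. A context $C$ is a term with exactly one occurrence of a hole $\Box$; $C[s]$ replaces the hole by $s$. A finite multi-distribution on a set $A$ is a finite multiset of pairs $(p:a)$ with $0<p\le 1$, $a\in A$, and probabilities summing to $1$. A PTRS is a finite set of rules $\ell \to \{p_1:r_1,\dots,p_k:r_k\}$ where $\ell\notin\mathcal{V}$ and every variable of each $r_j$ occurs in $\ell$. It induces the relation $s \to_{\mathcal{P}} \{p_1:s[r_1\sigma]_\pi,\dots,p_k:s[r_k\sigma]_\pi\}$ whenever $s|_\pi = \ell\sigma$ for such a rule, a position $\pi$ and a substitution $\sigma$. More generally a probabilistic abstract reduction system (PARS) on a set $A$ is a relation $\to$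 between elements of $A$ and finite multi-distributions on $A$. A $\to$-RST is a (possibly infinite) tree whose nodes $v$ are labeled by pairs $(p_v : a_v)$ with $p_v\in(0,1]$, $a_v \in A$, the root has $p=1$, and every non-leaf node $v$ with children $w_1,\dots,w_k$ satisfies $a_v \to \{\tfrac{p_{w_1}}{p_v}:a_{w_1},\dots,\tfrac{p_{w_k}}{p_v}:a_{w_k}\}$ (leaves need not be normal forms). The depth $\operatorname{d}(v)$ is the distance from the root, and the height is $\operatorname{h}(\mathfrak{T})=\sup_v \operatorname{d}(v)\in\mathbb{N}\cup\{\omega\}$. The termination probability is $|\mathfrak{T}| = \sum_{v \text{ leaf}} p_v$; the expected derivation length is $\operatorname{edl}(\mathfrak{T})=\infty$ if $|\mathfrak{T}|<1$ and $\sum_{v\text{ leaf}}\operatorname{d}(v)\cdot p_v$ otherwise. A PARS (in particular a PTRS) is AST if $|\mathfrak{T}|=1$ for every $\to$-RST $\mathfrak{T}$, and PAST if $\operatorname{edl}(\mathfrak{T})<\infty$ for every $\to$-RST $\mathfrak{T}$. *)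

(* Defs.v *)
From HB Require Import structures.
From mathcomp Require Import all_boot all_order all_algebra.
From mathcomp Require Import finmap multiset.
From mathcomp Require Import all_classical all_reals all_analysis.

Set Implicit Arguments.
Unset Strict Implicit.
Unset Printing Implicit Defensive.

Import Order.TTheory GRing.Theory Num.Theory.

Local Open Scope classical_set_scope.
Local Open Scope ring_scope.

Record mdist (R : realType) (A : choiceType) := Mdist {
  mset_of_mdist :> multiset (R * A)%type;
  mdist_axiom :
    all (fun x : R * A => 0 < x.1 <= 1) mset_of_mdist &&
    (\sum_(x <- mset_of_mdist) x.1 == 1) }.

HB.instance Definition _ (R : realType) (A : choiceType) :=
  [isSub for @mset_of_mdist R A].
HB.instance Definition _ (R : realType) (A : choiceType) :=
  [Choice of mdist R A by <:].

Definition mset_map (A B : choiceType) (f : A -> B) (m : multiset A) :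
  multiset B := seq_mset [seq f x | x <- m].

Lemma mdist_map_axiom (R : realType) (A B : choiceType) (f : A -> B)
    (mu : mdist R A) (m := mset_map (fun x : R * A => (x.1, f x.2)) mu) :
  all (fun x : R * B => 0 < x.1 <= 1) m && (\sum_(x <- m) x.1 == 1).
Proof.
have hp := perm_eq_seq_mset [seq (x.1, f x.2) | x : R * A <- mu].
rewrite (perm_all _ hp) (perm_big _ hp) /= all_map big_map /=.
exact: mdist_axiom mu.
Qed.

Definition mdist_map (R : realType) (A B : choiceType) (f : A -> B)
  (mu : mdist R A) : mdist R B := Mdist (mdist_map_axiom f mu).

Definition pars (R : realType) (A : choiceType) := A -> mdist R A -> Prop.

(* The nodes of a tree are Gorn addresses: the root is [::] and the children
   of v are rcons v 0, ..., rcons v (k - 1) with k = nchild T v. Every finitely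
   branching tree is of this form up to isomorphism, and finite branching is
   forced since multi-distributions are finite. The values of the three fields
   at addresses that are not nodes are irrelevant. *)
Record tree (R : realType) (A : choiceType) := Tree {
  nchild : seq nat -> nat;
  prob : seq nat -> R;
  lab : seq nat -> A }.

Section Trees.
Variables (R : realType) (A : choiceType).
Implicit Types (T : tree R A) (v : seq nat) (step : pars R A).

Inductive node T : seq nat -> Prop :=
| node_root : node T [::]
| node_child v i : node T v -> (i < nchild T v)%N -> node T (rcons v i).

Definition leaf T v : Prop := node T v /\ nchild T v = 0%N.

Definition children T v : seq (seq nat) :=
  [seq rcons v i | i <- iota 0 (nchild T v)].

Definition is_rst step T : Prop :=
  [/\ prob T [::] = 1,
      forall v, node T v -> 0 < prob T v <= 1 &
      forall v, node T v -> ~ leaf T v ->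
        exists2 mu : mdist R A, step (lab T v) mu &
          mu = seq_mset [seq (prob T w / prob T v, lab T w) | w <- children T v]
            :> multiset _].

Definition height T : \bar R :=
  ereal_sup [set ((size v)%:R)%:E | v in node T].

Definition term_prob T : \bar R := \esum_(v in leaf T) (prob T v)%:E.

Definition edl T : \bar R :=
  if (term_prob T < 1)%E then +oo%E
  else \esum_(v in leaf T) ((size v)%:R * prob T v)%:E.

Definition AST step : Prop :=
  forall T, is_rst step T -> term_prob T = 1%E.

Definition PAST step : Prop :=
  forall T, is_rst step T -> (edl T < +oo)%E.

End Trees.

Record signature := Signature { symb :> finType; arity : symb -> nat }.

Inductive term (S : signature) (V : Type) : Type :=
| Var of V
| App (f : S) of {ffun 'I_(arity f) -> term S V}.

Arguments Var {S V}.
Arguments App {S V}.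

HB.instance Definition _ (S : signature) (V : Type) := gen_eqMixin (term S V).
HB.instance Definition _ (S : signature) (V : Type) :=
  gen_choiceMixin (term S V).

Section Terms.
Variable S : signature.

Fixpoint bind (V W : Type) (s : V -> term S W) (t : term S V) : term S W :=
  match t with
  | Var x => s x
  | App f a => App f [ffun i => bind s (a i)]
  end.

Variable V : Type.
Implicit Types (t r : term S V) (p : seq nat).

(* Argument indices in positions start at 0; None means that p is not a
   position of t. *)
Fixpoint subterm_at t p : option (term S V) :=
  match p with
  | [::] => Some t
  | i :: p' =>
    match t with
    | Var _ => None
    | App f a =>
      if insub i is Some j then subterm_at (a j) p' else None
    end
  end.

(* Only meaningful when p is a position of t. *)
Fixpoint replace_at t p r : term S V :=
  match p with
  | [::] => r
  | i :: p' =>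
    match t with
    | Var _ => t
    | App f a =>
      App f [ffun j => if val j == i then replace_at (a j) p' r else a j]
    end
  end.

Definition vars t : set V :=
  [set x | exists p, subterm_at t p = Some (Var x)].

Record subst := Subst {
  subst_fun :> V -> term S V;
  subst_finite : finite_set [set x | subst_fun x <> Var x] }.

End Terms.

(* The hole is the extra variable None. *)
Record context (S : signature) (V : Type) := Context {
  context_term :> term S (option V);
  context_hole : exists! p, subterm_at context_term p = Some (Var None) }.

Definition fill (S : signature) (V : Type) (C : context S V) (s : term S V) :
    term S V :=
  bind (fun o => if o is Some x then Var x else s) C.

Definition rule (R : realType) (S : signature) (V : Type) : choiceType :=
  (term S V * mdist R (term S V))%type.

Record ptrs (R : realType) (S : signature) (V : Type) := Ptrs {
  rules : {fset rule R S V};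
  rules_lhs : forall rl, rl \in rules -> forall x, rl.1 <> Var x;
  rules_vars : forall rl, rl \in rules ->
    forall pr, pr \in (rl.2 : multiset _) -> vars pr.2 `<=` vars rl.1 }.

Definition rewrites (R : realType) (S : signature) (V : Type)
    (P : ptrs R S V) : pars R (term S V) :=
  fun s mu => exists rl p (sigma : subst S V),
    [/\ rl \in rules P,
        subterm_at s p = Some (bind sigma rl.1) &
        mu = mdist_map (fun r => replace_at s p (bind sigma r)) rl.2].

(* Main.v *)
(** A leaf of the given tree T is an instance, under a context and a
substitution, of its root, and rewriting is stable under contexts and
substitutions. Hence the set of all terms F t_v, for v an inner node of T and
F a map commuting with the rewrite relation, is a trap: each of its elements
rewrites to a multi-distribution supported in the set. Rewriting forever
inside the trap yields a tree without leaves, whose termination probability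
is 0. *)
Require Import Defs.
From mathcomp Require Import all_boot all_order all_algebra.
From mathcomp Require Import finmap multiset.
From mathcomp Require Import all_classical all_reals all_analysis.

Set Implicit Arguments.
Unset Strict Implicit.
Unset Printing Implicit Defensive.

Import Order.TTheory GRing.Theory Num.Theory.

Local Open Scope classical_set_scope.
Local Open Scope ring_scope.

(* mathcomp-analysis also has an [mdist], the distance of a metric space. *)
Local Notation mdist := Defs.mdist.

Section MultiDistributions.
Variable R : realType.

Lemma mem_mdist_map (A B : choiceType) (f : A -> B) (mu : mdist R A) x :
  x \in (mdist_map f mu : multiset _) ->
  exists2 y, y \in (mu : multiset _) & x = (y.1, f y.2).
Proof.
move=> xmu; have : x \in [seq (y.1, f y.2) | y <- mu].
  by rewrite -(perm_mem (perm_eq_seq_mset _)).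
by move=> /mapP[y ymu ->]; exists y.
Qed.

Lemma mdist_map_comp (A B C : choiceType) (g : B -> C) (f : A -> B)
    (mu : mdist R A) :
  mdist_map g (mdist_map f mu) = mdist_map (g \o f) mu.
Proof.
apply/val_inj/eq_seq_msetP => /=.
rewrite (perm_trans (perm_map _ (perm_eq_seq_mset _))) //.
by rewrite -map_comp.
Qed.

(** An empty sum is 0, not 1. This gives every node of the tree built below a child. *)
Lemma mdist_neq_nil (A : choiceType) (mu : mdist R A) :
  (0 < size (mu : multiset _))%N.
Proof.
have /andP[_] := mdist_axiom mu.
by case: (mu : seq _) => //; rewrite big_nil eq_sym oner_eq0.
Qed.

End MultiDistributions.

Section Trap.
Variables (R : realType) (A : choiceType) (step : pars R A).

Definition trap (X : set A) : Prop :=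
  forall a, X a -> exists2 mu : mdist R A, step a mu &
    forall x, x \in (mu : multiset _) -> X x.2.

Lemma trap_leafless_rst (X : set A) a0 : trap X -> X a0 ->
  exists2 T : tree R A, is_rst step T & leaf T = set0.
Proof.
move=> trapX Xa0.
have [m mP] : {m : A -> mdist R A & forall a, X a -> step a (m a) /\
    forall x, x \in (m a : multiset _) -> X x.2}.
  apply: (@choice _ _ (fun a mu => X a -> step a mu /\
    forall x, x \in (mu : multiset _) -> X x.2)) => a.
  have [Xa|nXa] := pselect (X a).
    by have [mu amu muX] := trapX a Xa; exists mu.
  (* Outside [X] any value will do; the step of [a0] supplies one. *)
  by have [mu _ _] := trapX a0 Xa0; exists mu.
(* A node's pair (probability, label) is found by following its address from the root, entry [i] of
   the chosen step giving child [i]. *)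
pose child (pa : R * A) i :=
  let x := nth (0, pa.2) (m pa.2 : multiset _) i in (pa.1 * x.1, x.2).
pose st v := foldl child (1, a0) v.
pose T := Tree (fun v => size (m (st v).2 : multiset _))
  (fun v => (st v).1) (fun v => (st v).2).
have stS v i : st (rcons v i) = child (st v) i by rewrite /st foldl_rcons.
have nodeP v : node T v -> 0 < (st v).1 <= 1 /\ X (st v).2.
  elim=> [|{}v i _ [/andP[p_gt0 p_le1] Xv] iv]; first by rewrite /= ltr01 lexx.
  rewrite stS /child /=; set x := nth _ _ _.
  have xm : x \in (m (st v).2 : multiset _) by exact: mem_nth.
  have /andP[/allP/(_ _ xm)/andP[x_gt0 x_le1] _] := mdist_axiom (m (st v).2).
  split; last exact: (mP _ Xv).2.
  by rewrite mulr_gt0//= mulr_ile1// ltW.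
have leafF v : ~ leaf T v.
  by move=> [_ /= v0]; have := mdist_neq_nil (m (st v).2); rewrite v0.
exists T; last by apply/seteqP; split => // v /leafF.
split => // v Tv; first exact: (nodeP v Tv).1.
have [/andP[p_gt0 _] Xv] := nodeP v Tv.
move=> _; exists (m (st v).2); first exact: (mP _ Xv).1.
rewrite -[LHS]seq_mset_id; congr seq_mset.
(* With the same default as in [child], the two sequences agree at every index, even out of range,
   as [eq_map] demands. *)
rewrite /children -map_comp -[LHS](mkseq_nth (0, (st v).2)).
apply: eq_map => i /=; rewrite stS /child /=.
by rewrite mulrC mulKf ?gt_eqF// -surjective_pairing.
Qed.

(** A leafless tree refutes both properties: a termination probability below 1 makes [edl] infinite
    by definition. *)
Lemma trap_nonterminating (X : set A) a0 : trap X -> X a0 ->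
  ~ AST step /\ ~ PAST step.
Proof.
move=> trapX Xa0; have [T Trst leafT0] := trap_leafless_rst trapX Xa0.
have T0 : term_prob T = 0%E by rewrite /term_prob leafT0 esum_set0.
split=> [/(_ T Trst)|/(_ T Trst)]; last by rewrite /edl T0 lte01 ltxx.
by rewrite T0 => /esym/eqP; rewrite onee_eq0.
Qed.

(** Abstracts closure under contexts and substitutions, so that the loop argument needs no terms. *)
Definition step_stable (f : A -> A) : Prop :=
  forall a mu, step a mu -> step (f a) (mdist_map f mu).

Lemma step_stable_id : step_stable id.
Proof.
move=> a mu amu; suff -> : mdist_map id mu = mu by [].
apply/val_inj => /=; rewrite -[RHS]seq_mset_id; congr seq_mset.
by rewrite -[RHS]map_id; apply: eq_map => -[].
Qed.

Lemma step_stable_comp f g :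
  step_stable f -> step_stable g -> step_stable (f \o g).
Proof. by move=> fs gs a mu amu; rewrite -mdist_map_comp; exact/fs/gs. Qed.

(** A root without children is the only node, and its depth is 0. *)
Lemma height_gt0_root (T : tree R A) : (0 < height T)%E -> ~ leaf T [::].
Proof.
move=> hT [_ root0]; move: hT; apply/negP; rewrite -leNgt.
apply: ge_ereal_sup => _ [v Tv <-].
suff -> : v = [::] by [].
elim: Tv => // {}v i _ ->; by rewrite root0.
Qed.

Lemma looping_nonterminating (T : tree R A) :
  is_rst step T -> (0 < height T)%E ->
  (forall v, leaf T v ->
     exists2 f, step_stable f & lab T v = f (lab T [::])) ->
  ~ AST step /\ ~ PAST step.
Proof.
move=> [_ _ Tstep] /height_gt0_root rootN loopT.
pose X := [set a | exists F v,
  [/\ step_stable F, node T v, ~ leaf T v & a = F (lab T v)]].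
apply: (@trap_nonterminating X (lab T [::])); last first.
  exists id, [::]; split => //; [exact: step_stable_id|exact: node_root].
move=> _ [F [v [Fs Tv vN ->]]]; have [mu vmu muE] := Tstep v Tv vN.
exists (mdist_map F mu) => [|_ /mem_mdist_map[y + ->]/=]; first exact: Fs.
rewrite muE (perm_mem (perm_eq_seq_mset _)) => /mapP[w + ->]/=.
move=> /mapP[i]; rewrite mem_iota add0n => /andP[_ iv] wE.
have Tw : node T w by rewrite wE; exact: node_child.
(* An inner child keeps [F]; a leaf is replaced by the root, and its map [f] is absorbed into
   [F \o f]. *)
have [wleaf|wN] := pselect (leaf T w); last by exists F, w.
have [f fs ->] := loopT w wleaf.
exists (F \o f), [::]; split => //; [exact: step_stable_comp|exact: node_root].
Qed.

End Trap.

Section Stability.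
Variable S : signature.

Lemma term_arg_ind (V : Type) (Q : term S V -> Prop) :
  (forall x, Q (Var x)) ->
  (forall f (a : {ffun 'I_(arity f) -> term S V}),
    (forall i, Q (a i)) -> Q (App f a)) ->
  forall t, Q t.
Proof.
move=> Qv Qa; fix IH 1 => -[x|f a]; first exact: Qv.
by apply: Qa => i; exact: IH.
Qed.

Lemma bind_comp (U V W : Type) (s : V -> term S W) (s' : U -> term S V) t :
  bind s (bind s' t) = bind (bind s \o s') t.
Proof.
elim/term_arg_ind: t => //= f a IH.
by congr App; apply/ffunP => i; rewrite !ffunE.
Qed.

Lemma eq_bind_vars (V W : Type) (s s' : V -> term S W) t :
  (forall x, vars t x -> s x = s' x) -> bind s t = bind s' t.
Proof.
elim/term_arg_ind: t => [x|f a IH] ss' /=; first by apply: ss'; exists [::].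
congr App; apply/ffunP => i; rewrite !ffunE; apply: IH => x [p px].
by apply: ss'; exists (val i :: p) => /=; rewrite valK.
Qed.

Lemma subterm_at_nil (V : Type) (t : term S V) : subterm_at t [::] = Some t.
Proof. by case: t. Qed.

Lemma replace_at_nil (V : Type) (t r : term S V) : replace_at t [::] r = r.
Proof. by case: t. Qed.

Lemma subterm_at_bind (V W : Type) (s : V -> term S W) t p u :
  subterm_at t p = Some u -> subterm_at (bind s t) p = Some (bind s u).
Proof.
elim: p t => [t|i p IH [x|f a]] //=; first by rewrite !subterm_at_nil => -[->].
by case: insub => // j /IH; rewrite ffunE.
Qed.

(** That [p] is a position of [t] matters: below a variable of [t], [replace_at t p r] changes
    nothing, while [bind s t] may have a subterm there. *)
Lemma replace_at_bind (V W : Type) (s : V -> term S W) t p u r :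
  subterm_at t p = Some u ->
  replace_at (bind s t) p (bind s r) = bind s (replace_at t p r).
Proof.
elim: p t => [t|i p IH [x|f a]] //=; first by rewrite !replace_at_nil.
case: insubP => // j _ ji tp; congr App; apply/ffunP => k; rewrite !ffunE.
case: ifP => // /eqP ki; apply: IH.
by have -> : k = j by apply: val_inj; rewrite ji.
Qed.

Lemma subterm_at_cat (V : Type) (t : term S V) q p u :
  subterm_at t q = Some u -> subterm_at t (q ++ p) = subterm_at u p.
Proof.
elim: q t => [t|i q IH [x|f a]] //=; first by rewrite subterm_at_nil => -[->].
by case: insub => // j; exact: IH.
Qed.

Variable V : Type.

(** [fill C s] unfolds to [bind (plug s) C]. *)
Definition plug (s : term S V) (o : option V) : term S V :=
  if o is Some x then Var x else s.

(** Stated for a bare term with a unique hole position [q], so that induction on [q] can descend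
    into the argument holding the hole. *)
Lemma replace_at_plug (c : term S (option V)) q p (s r : term S V) :
  subterm_at c q = Some (Var None) ->
  (forall q', subterm_at c q' = Some (Var None) -> q' = q) ->
  replace_at (bind (plug s) c) (q ++ p) r = bind (plug (replace_at s p r)) c.
Proof.
elim: q c => [c|i q IH [x|f a]] //=; first by rewrite subterm_at_nil => -[->].
case: insubP => // j _ ji cq uniq_q.
have uniq_arg k q' : subterm_at (a k) q' = Some (Var None) ->
    val k = i /\ q' = q.
  move=> kq'; suff : val k :: q' = i :: q by case.
  by apply: uniq_q; rewrite /= valK.
congr App; apply/ffunP => k; rewrite !ffunE; case: eqP => ki.
  have -> : k = j by apply: val_inj; rewrite ji.
  by apply: IH => // q' /uniq_arg[].
(* An argument off the path has no hole, so both plugs agree on its variables. *)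
by apply: eq_bind_vars => -[//|[q' /uniq_arg[]]].
Qed.

(** A variable fixed by [s'] and moved by the composition is moved by [s]. *)
Lemma subst_comp_finite (s s' : subst S V) :
  finite_set [set x | (bind s \o s') x <> Var x].
Proof.
apply: (@sub_finite_set _ _
  ([set x | s' x <> Var x] `|` [set x | s x <> Var x])); last first.
  by rewrite finite_setU; split; exact: subst_finite.
move=> x /= ss'x; have [s'x|] := pselect (s' x = Var x); last by left.
by right; rewrite s'x in ss'x.
Qed.

Definition subst_comp (s s' : subst S V) : subst S V :=
  Subst (subst_comp_finite s s').

Variables (R : realType) (P : ptrs R S V).

(** Same rule and position, with the matching substitution composed with [s]. *)
Lemma rewrites_bind (s : subst S V) : step_stable (rewrites P) (bind s).
Proof.
move=> t _ [rl [p [s' [rlP tp ->]]]]; exists rl, p, (subst_comp s s').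
split=> //; first by rewrite (subterm_at_bind _ tp) bind_comp.
rewrite mdist_map_comp; congr mdist_map; apply/funext => r /=.
by rewrite -(replace_at_bind _ _ tp) bind_comp.
Qed.

(** Same rule and substitution, with the position prefixed by that of the hole. *)
Lemma rewrites_fill (C : context S V) : step_stable (rewrites P) (fill C).
Proof.
have [q [Cq uniq_q]] := context_hole C.
move=> t _ [rl [p [s [rlP tp ->]]]]; exists rl, (q ++ p), s.
split=> //; first by rewrite (subterm_at_cat _ (subterm_at_bind _ Cq)).
rewrite mdist_map_comp; congr mdist_map; apply/funext => r /=.
by rewrite [RHS](replace_at_plug _ _ _ Cq)// => q' /uniq_q.
Qed.

End Stability.

Theorem theorem4 (R : realType) (S : signature) (V : Type)
    (V_infinite : infinite_set [set: V])
    (P : ptrs R S V) (T : tree R (term S V))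
    (T_rst : is_rst (rewrites P) T)
    (T_height : (0 < height T)%E)
    (T_loop : forall v, leaf T v ->
       exists (C : context S V) (sigma : subst S V),
         lab T v = fill C (bind sigma (lab T [::]))) :
  ~ AST (rewrites P) /\ ~ PAST (rewrites P).
Proof.
apply: (looping_nonterminating T_rst T_height) => v /T_loop[C [sigma ->]].
exists (fill C \o bind sigma) => //.
by apply: step_stable_comp; [exact: rewrites_fill|exact: rewrites_bind].
Qed.
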